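(* For every function $f:\mathbb N\to\mathbb N$ there exist a finite configuration $A\subseteq\mathbb Z^n$ and a Markov basis $M$ of $I_A$ such that $\deg_M>f(\deg_{Gr_A})$, $\deg_M>f(\deg_{\mathcal U_A})$ and $\deg_M>f(\deg_{\mathcal C_A})$. That is, the degrees of the elements of a Markov basis cannot be bounded above by any function of the maximal degree of the elements of the Graver basis, of the universal Gröbner basis, or of the circuits.
   Context: Let $\mathbb K$ be a field and $A=\{\mathbf a_1,\dots,\mathbf a_m\}\subseteq\mathbb Z^n$ finite. For $\mathbf u\in\mathbb N^m$, $\mathbf x^{\mathbf u}=x_1^{u_1}\cdots x_m^{u_m}$ has degree $u_1+\dots+u_m$ and $A$-degree $\sum u_i\mathbf a_i$. The toric ideal $I_A\subseteq\mathbb K[x_1,\dots,x_m]$ is generated by all binomials $\mathbf x^{\mathbf u}-\mathbf x^{\mathbf v}$ of equal $A$-degree. The degree of a binomial is the maximum of the degrees of its two monomials. $Gr_A$ (Graver basis) is the set of primitive binomials: irreducible binomials $\mathbf x^{\mathbf u}-\mathbf x^{\mathbf v}\in I_A$ such that no other binomial $\mathbf x^{\mathbf w}-\mathbf x^{\mathbf z}\in I_A$ has $\mathbf x^{\mathbf w}\mid\mathbf x^{\mathbf u}$, $\mathbf x^{\mathbf z}\mid\mathbf x^{\mathbf v}$. $\mathcal U_A$ is the union of all reduced Gröbner bases of $I_A$. $\mathcal C_A$ is the set of circuits (irreducible nonzero binomials of $I_A$ of minimal support). A Markov basis is a generating set of $I_A$ of binomials minimal under inclusion. For a finite set $S$ of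 binomials, $\deg_S$ is the maximal degree of its elements. *)

(* Defs.v *)
From HB Require Import structures.
From mathcomp Require Import all_boot all_order all_algebra.
From mathcomp Require Import mpoly.

Set Implicit Arguments.
Unset Strict Implicit.
Unset Printing Implicit Defensive.

Import GRing.Theory.
Local Open Scope ring_scope.

Section Polynomials.
Variables (K : fieldType) (m : nat).
Implicit Types (S T M I : {mpoly K[m]} -> Prop) (p q g : {mpoly K[m]}).

Definition ideal_gen S p : Prop :=
  exists (k : nat) (c g : 'I_k -> {mpoly K[m]}),
    (forall i, S (g i)) /\ p = \sum_(i < k) c i * g i.

(* The two monomials are required to be distinct: 0 is not a binomial. *)
Definition is_binomial p : Prop :=
  exists u v : 'X_{1..m}, u <> v /\ p = 'X_[u] - 'X_[v].

Definition irreducible_mpoly p : Prop :=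
  [/\ p != 0, p \isn't a GRing.unit
    & forall q r : {mpoly K[m]},
        p = q * r -> q \is a GRing.unit \/ r \is a GRing.unit].

(* [msize p] is one more than the total degree, so on a binomial [total_deg]
   is the maximum of the degrees of its two monomials. *)
Definition total_deg p : nat := (msize p).-1.

Definition is_deg_of S (d : nat) : Prop :=
  (exists2 p, S p & total_deg p = d) /\ (forall p, S p -> total_deg p <= d)%N.

Definition var_support p : {set 'I_m} :=
  [set i : 'I_m | has (fun u : 'X_{1..m} => u i != 0%N) (msupp p)].

Definition is_monomial_order (le : rel 'X_{1..m}) : Prop :=
  [/\ antisymmetric le, transitive le, total le,
      forall u, le 0%MM u
    & forall u v w, le u v -> le (u + w)%MM (v + w)%MM].

Section Groebner.
Variable le : rel 'X_{1..m}.

Definition is_lead_monom p (u : 'X_{1..m}) : Prop :=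
  u \in msupp p /\ {in msupp p, forall v, le v u}.

Definition lead_monoms S q : Prop :=
  exists p u, [/\ S p, is_lead_monom p u & q = 'X_[u]].

Definition is_groebner_basis I (G : seq {mpoly K[m]}) : Prop :=
  (forall g, g \in G -> I g) /\
  (forall q, ideal_gen (lead_monoms I) q <->
             ideal_gen (lead_monoms (fun g => g \in G)) q).

Definition is_reduced_groebner_basis I (G : seq {mpoly K[m]}) : Prop :=
  [/\ is_groebner_basis I G,
      forall g, g \in G -> exists2 u, is_lead_monom g u & g@_u = 1
    & forall g h u v, g \in G -> h \in G -> g <> h ->
        is_lead_monom g u -> v \in msupp h -> ~~ (u <= v)%MM].

End Groebner.

End Polynomials.

Section Toric.
Variables (K : fieldType) (n m : nat) (A : 'I_m -> 'cV[int]_n).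
Implicit Types (M N : {mpoly K[m]} -> Prop) (p : {mpoly K[m]}).

Definition A_degree (u : 'X_{1..m}) : 'cV[int]_n := \sum_(i < m) A i *+ u i.

Definition toric_ideal : {mpoly K[m]} -> Prop :=
  ideal_gen (fun p => exists u v : 'X_{1..m},
    A_degree u = A_degree v /\ p = 'X_[u] - 'X_[v]).

Definition graver_basis p : Prop :=
  exists u v : 'X_{1..m},
    [/\ p = 'X_[u] - 'X_[v], irreducible_mpoly p, toric_ideal p
      & forall w z : 'X_{1..m}, w <> z ->
          toric_ideal ('X_[w] - 'X_[z]) ->
          (w <= u)%MM -> (z <= v)%MM -> 'X_[w] - 'X_[z] = p].

Definition universal_groebner_basis p : Prop :=
  exists (le : rel 'X_{1..m}) (G : seq {mpoly K[m]}),
    [/\ is_monomial_order le,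
        is_reduced_groebner_basis le toric_ideal G & p \in G].

Definition circuits p : Prop :=
  [/\ is_binomial p, irreducible_mpoly p, toric_ideal p
    & forall q : {mpoly K[m]}, is_binomial q -> toric_ideal q ->
        ~~ (var_support q \proper var_support p)].

Definition generates_toric_ideal M : Prop :=
  forall p, ideal_gen M p <-> toric_ideal p.

Definition is_markov_basis M : Prop :=
  [/\ forall p, M p -> is_binomial p,
      generates_toric_ideal M
    & forall N, (forall p, N p -> M p) -> generates_toric_ideal N ->
        forall p, M p -> N p].

End Toric.

(* Main.v *)
Require Import Defs.
From mathcomp Require Import all_boot all_order all_algebra.
From mathcomp Require Import mpoly.

(** For the configuration [A = {0}] the toric ideal of [K[x]] is [(x - 1)].
    Its irreducible elements are the unit multiples of [x - 1], and the elements
    of a reduced Groebner basis have degree at most 1 because [x] is a leading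
    monomial of the ideal; hence the Graver basis, the universal Groebner basis
    and the circuits all have degree 1.  On the other hand
    [x - 1 = (x^(d+1) - 1) - x (x^d - 1)], so [{x^d - 1, x^(d+1) - 1}] generates
    the ideal, and for [d > 1] neither binomial generates it alone: this is a
    Markov basis of degree [d + 1]. *)

Set Implicit Arguments.
Unset Strict Implicit.
Unset Printing Implicit Defensive.

Import GRing.Theory.
Local Open Scope ring_scope.

(** * Ideals given by generators, units and irreducibility, in any number of variables *)

Section IdealGen.
Variables (K : fieldType) (m : nat).
Implicit Types (S T : {mpoly K[m]} -> Prop) (p h r : {mpoly K[m]}).

Lemma ideal_gen_dvd S h p :
  (forall s, S s -> exists r, s = h * r) -> ideal_gen S p -> exists r, p = h * r.
Proof.
move=> Sh [k [c [g [Sg ->]]]].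
elim/big_ind: _ => [|_ _ [r1 ->] [r2 ->]|i _].
- by exists 0; rewrite mulr0.
- by exists (r1 + r2); rewrite mulrDr.
- by have [r ->] := Sh _ (Sg i); exists (c i * r); rewrite mulrCA.
Qed.

Lemma ideal_gen_mulr S h r : S h -> ideal_gen S (h * r).
Proof.
move=> Sh; exists 1%N, (fun=> r), (fun=> h); split=> //.
by rewrite big_ord1 mulrC.
Qed.

Lemma ideal_gen_sub S T p :
  (forall s, S s -> T s) -> ideal_gen S p -> ideal_gen T p.
Proof. by move=> ST [k [c [g [Sg ->]]]]; exists k, c, g; split=> // i; apply: ST. Qed.

Lemma msize_unit p : p \is a GRing.unit -> msize p = 1%N.
Proof. by case/andP=> /eqP ->; rewrite mcoeffC eqxx mulr1 msizeC unitfE => ->. Qed.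

Lemma unit_msize1 p : msize p = 1%N -> p \is a GRing.unit.
Proof.
move/eqP/msize_poly1P=> [c c0 ->].
by apply/andP; rewrite mcoeffC !eqxx mulr1 unitfE.
Qed.

(** Degrees add in a product of nonzero polynomials, so in a factorization of a degree 1 polynomial
    one factor is a nonzero constant. Recall that [msize] is the degree plus one. *)
Lemma irreducible_msize2 p : msize p = 2%N -> irreducible_mpoly p.
Proof.
move=> p2; have p0 : p != 0 by rewrite -msize_poly_eq0 p2.
split=> //; first by apply/negP=> /msize_unit; rewrite p2.
move=> q r pqr; move: p0 p2; rewrite pqr mulf_eq0 negb_or => /andP[q0 r0].
rewrite msizeM // (mpolySpred _ q0) (mpolySpred _ r0) addSn addnS /= => -[].
case Eq: (msize q).-1 => [|k].
  by move=> _; left; apply: unit_msize1; rewrite (mpolySpred _ q0) Eq.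
rewrite addSn => -[] /eqP; rewrite addn_eq0 => /andP[_ /eqP Er].
by right; apply: unit_msize1; rewrite (mpolySpred _ r0) Er.
Qed.

End IdealGen.

(** * The toric ideal of the zero configuration in one variable *)

Section OneVariable.
Variable K : fieldType.
Implicit Types (p q r : {mpoly K[1]}) (u v w : 'X_{1..1}).

Local Notation X := ('X_ord0 : {mpoly K[1]}).
Local Notation A0 := (fun _ : 'I_1 => 0 : 'cV[int]_1).

Lemma mnm_ord1_inj u v : u ord0 = v ord0 -> u = v.
Proof. by move=> uv; apply/mnmP=> i; rewrite (ord1 i). Qed.

Lemma mpolyX_ord1 u : 'X_[u] = X ^+ u ord0.
Proof. by rewrite mpolyXE_id big_ord1. Qed.

Lemma msize_Xn_sub1 d : (0 < d)%N -> msize (X ^+ d - 1) = d.+1.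
Proof.
move=> d0; rewrite mpolyXn; apply/eqP; rewrite eqn_leq; apply/andP; split.
  apply: leq_trans (msizeD_le _ _) _.
  by rewrite msizeN msize1 msizeX mdegMn mdeg1 mul1n geq_max leqnn.
(* Lower bound: as [0 < d], the monomial x^d is not cancelled by the constant term. *)
have -> : d = mdeg (U_(ord0 : 'I_1) *+ d)%MM by rewrite mdegMn mdeg1 mul1n.
apply: msize_mdeg_lt.
rewrite mdegMn mdeg1 mul1n mcoeff_msupp mcoeffB mcoeffX mcoeff1 eqxx.
by rewrite -mdeg_eq0 mdegMn mdeg1 mul1n -[d]prednK //= subr0 oner_neq0.
Qed.

Lemma msize_X_sub1 : msize (X - 1) = 2%N.
Proof. by rewrite -[X]expr1 msize_Xn_sub1. Qed.

Lemma X_sub1_neq0 : X - 1 != 0.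
Proof. by rewrite -msize_poly_eq0 msize_X_sub1. Qed.

Lemma toric_ideal_binomial u v : toric_ideal A0 ('X_[u] - 'X_[v] : {mpoly K[1]}).
Proof.
rewrite -[_ - _]mulr1; apply: ideal_gen_mulr; exists u, v; split=> //.
by rewrite /A_degree !big1 // => i _; rewrite mul0rn.
Qed.

Lemma toric_ideal_Xn_sub1 d : toric_ideal A0 (X ^+ d - 1).
Proof. by rewrite mpolyXn -mpolyX0; apply: toric_ideal_binomial. Qed.

(** Every monomial has A-degree 0, so all differences of monomials are generators; x^u - x^v = x^v
    (x^(u-v) - 1) is a multiple of x - 1, and x - 1 is itself a generator. *)
Lemma toric_idealP p : toric_ideal A0 p <-> exists r, p = (X - 1) * r.
Proof.
split=> [|[r ->]]; last first.
  apply: ideal_gen_mulr; exists U_(ord0)%MM, 0%MM.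
  by split; [rewrite /A_degree !big1 // => i _; rewrite mul0rn | rewrite mpolyX0].
apply: ideal_gen_dvd => _ [u [v [_ ->]]]; rewrite (mpolyX_ord1 u) (mpolyX_ord1 v).
wlog le_vu : u v / (v ord0 <= u ord0)%N => [IH|].
  case: (leqP (v ord0) (u ord0)) => [/IH //|/ltnW /IH [r Er]].
  by exists (- r); rewrite mulrN -Er opprB.
rewrite -(subnK le_vu) exprD -{2}[X ^+ v ord0]mul1r -mulrBl subrX1 -mulrA.
by eexists.
Qed.

Lemma meval1_toric_ideal p : toric_ideal A0 p -> p.@[fun=> 1] = 0.
Proof. by case/toric_idealP=> r ->; rewrite mevalM mevalB mevalXU meval1 subrr mul0r. Qed.

(** The cofactor of x - 1 in an irreducible element must be a unit. This gives the upper bound for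
    both the Graver basis and the circuits. *)
Lemma irreducible_toric_ideal_deg p :
  irreducible_mpoly p -> toric_ideal A0 p -> total_deg p = 1%N.
Proof.
move=> [p0 _ irr] /toric_idealP[r Ep].
have [/msize_unit|/msize_unit r1] := irr _ _ Ep; first by rewrite msize_X_sub1.
have r0 : r != 0 by rewrite -msize_poly_eq0 r1.
by rewrite /total_deg Ep msizeM ?X_sub1_neq0 // r1 msize_X_sub1.
Qed.

(** * Graver basis and circuits *)

Lemma total_deg_X_sub1 : total_deg (X - 1) = 1%N.
Proof. by rewrite /total_deg msize_X_sub1. Qed.

Lemma X_sub1_binomial : X - 1 = 'X_[U_(ord0)] - 'X_[0%MM].
Proof. by rewrite mpolyX0. Qed.

Lemma U_neq0 : U_(ord0 : 'I_1)%MM <> 0%MM.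
Proof. by move/eqP; rewrite mnm1_eq0. Qed.

Lemma graver_basis_deg : is_deg_of (@graver_basis K 1 1 A0) 1.
Proof.
split=> [|p [u [v [_ irr Ip _]]]]; last by rewrite irreducible_toric_ideal_deg.
exists (X - 1); last exact: total_deg_X_sub1.
exists U_(ord0)%MM, 0%MM; split=> [|||w z wz _ le_w le_z].
- exact: X_sub1_binomial.
- exact/irreducible_msize2/msize_X_sub1.
- by rewrite X_sub1_binomial; apply: toric_ideal_binomial.
(* Primitivity: [z] divides 1 and [w] divides x, so with [w] distinct from [z] the only choice is x
   - 1. *)
- have z0 : z = 0%MM.
    apply: mnm_ord1_inj; move/mnm_lepP/(_ ord0): le_z.
    by rewrite mnm0E leqn0 => /eqP.
  rewrite X_sub1_binomial z0; congr ('X_[_] - _); apply: mnm_ord1_inj.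
  move/mnm_lepP/(_ ord0): le_w; rewrite mnm1E eqxx.
  case Ew: (w ord0) => [|[|k]] // _.
  by case: wz; rewrite z0; apply: mnm_ord1_inj; rewrite Ew mnm0E.
Qed.

Lemma circuits_deg : is_deg_of (@circuits K 1 1 A0) 1.
Proof.
split=> [|p [_ irr Ip _]]; last by rewrite irreducible_toric_ideal_deg.
exists (X - 1); last exact: total_deg_X_sub1.
split.
- by exists U_(ord0)%MM, 0%MM; split; [exact: U_neq0 | exact: X_sub1_binomial].
- exact/irreducible_msize2/msize_X_sub1.
- by rewrite X_sub1_binomial; apply: toric_ideal_binomial.
(* With a single variable, a strictly smaller support is empty; then both exponents of [q] vanish,
   contradicting that its monomials differ. *)
move=> q [u [v [uv ->]]] _; apply/negP=> /properP[_ [i _]].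
rewrite (ord1 i) inE => /hasPn supp0; move/eqP: uv => uv.
case/eqP: (uv); apply: mnm_ord1_inj.
have/eqP-> : u ord0 == 0%N.
  rewrite -[_ == _]negbK; apply: supp0.
  by rewrite mcoeff_msupp mcoeffB !mcoeffX eqxx [v == u]eq_sym (negPf uv) subr0 oner_neq0.
apply/esym/eqP; rewrite -[_ == _]negbK; apply: supp0.
by rewrite mcoeff_msupp mcoeffB !mcoeffX eqxx (negPf uv) sub0r oppr_eq0 oner_neq0.
Qed.

(** * Universal Gröbner basis *)

Definition deg_order : rel 'X_{1..1} := fun u v => (u ord0 <= v ord0)%N.

Lemma deg_order_monomial : is_monomial_order deg_order.
Proof.
split; rewrite /deg_order.
- by move=> u v; rewrite -eqn_leq => /eqP/mnm_ord1_inj.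
- by move=> v u w; apply: leq_trans.
- by move=> u v; apply: leq_total.
- by move=> u; rewrite mnm0E.
- by move=> u v w; rewrite !mnmDE leq_add2r.
Qed.

Lemma lead_monom_X_sub1 le :
  is_monomial_order le -> is_lead_monom le (X - 1) U_(ord0)%MM.
Proof.
move=> [_ _ tot le0 _]; split=> [|v].
  by rewrite mcoeff_msupp mcoeffB mcoeffX mcoeff1 eqxx mnm1_eq0 subr0 oner_neq0.
move/msuppB_le; rewrite -[1]mpolyX0 !msuppX mem_cat !inE.
by case/orP=> /eqP-> //; have := tot U_(ord0)%MM U_(ord0)%MM; rewrite orbb.
Qed.

Lemma X_sub1_reduced_groebner :
  is_reduced_groebner_basis deg_order (@toric_ideal K 1 1 A0) [:: X - 1].
Proof.
have lead1 := lead_monom_X_sub1 deg_order_monomial.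
have I1 : toric_ideal A0 (X - 1) by rewrite -[X]expr1; apply: toric_ideal_Xn_sub1.
split; last 2 first.
- move=> g; rewrite inE => /eqP->; exists U_(ord0)%MM => //.
  by rewrite mcoeffB mcoeffX mcoeff1 eqxx mnm1_eq0 subr0.
- by move=> g h u v; rewrite !inE => /eqP-> /eqP->.
split=> [g|q]; first by rewrite inE => /eqP->.
split; last first.
  apply: ideal_gen_sub => s [g [u [gG lead_u ->]]]; exists g, u; split=> //.
  by move: gG; rewrite inE => /eqP->.
case/(ideal_gen_dvd (h := X)) => [_ [p [u [Ip [u_p lead_u] ->]]]|r ->]; last first.
  by apply: ideal_gen_mulr; exists (X - 1), U_(ord0)%MM; split=> //; rewrite inE.
rewrite (mpolyX_ord1 u); case Eu: (u ord0) => [|k]; last by exists (X ^+ k); rewrite exprS.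
(* If the leading monomial were 1, [p] would be constant; vanishing at 1, it would be zero and have
   no leading monomial. *)
have p_const : (msize p <= 1)%N.
  rewrite msizeE; apply/bigmax_leqP_seq=> v v_p _.
  by have := lead_u _ v_p; rewrite /deg_order Eu mdegE big_ord1.
have := meval1_toric_ideal Ip; rewrite (msize1_polyC p_const) mevalC => p00.
by move: u_p; rewrite (msize1_polyC p_const) p00 mpolyC0 msupp0.
Qed.

(** If u < v as exponents, adding [u] to 0 <= v - u gives [le u v], and antisymmetry is
    contradicted. Hence every monomial order in one variable is the order by degree. *)
Lemma monomial_order_ord1 le u v :
  is_monomial_order le -> le v u -> (v ord0 <= u ord0)%N.
Proof.
move=> [anti _ _ le0 leD] le_vu; rewrite leqNgt; apply/negP=> lt_uv.
have Ev : v = (v - u + u)%MM.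
  by apply: mnm_ord1_inj; rewrite mnmDE mnmBE subnK // ltnW.
have le_uv : le u v by rewrite Ev -{1}[u]add0m; apply: leD.
by move: lt_uv; rewrite (anti u v) ?ltnn // le_uv.
Qed.

(** The coefficient of x^u on the right-hand side is 1, so it is nonzero in some summand, and all
    monomials of that summand are multiples of its generator. *)
Lemma ideal_gen_monomials (T : 'X_{1..1} -> Prop) u :
  ideal_gen (fun q : {mpoly K[1]} => exists2 v, T v & q = 'X_[v]) 'X_[u] ->
  exists2 v, T v & (v <= u)%MM.
Proof.
move=> [k [c [g [Tg Eu]]]].
have [i] : exists i, (c i * g i)@_u != 0.
  apply/existsP; apply: contraT => /existsPn all0.
  move/(congr1 (mcoeff u)): Eu; rewrite mcoeffX eqxx raddf_sum /= big1.
    by move/eqP; rewrite oner_eq0.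
  by move=> i _; apply/eqP/negPn/all0.
have [v Tv ->] := Tg i; rewrite -mcoeff_msupp => uc; exists v => //.
by move: uc; rewrite (perm_mem (msuppMX _ _)) => /mapP[w _ ->]; apply: lem_addr.
Qed.

Lemma universal_groebner_basis_deg :
  is_deg_of (@universal_groebner_basis K 1 1 A0) 1.
Proof.
split=> [|p [le [G [ord_le [[_ leadG] lcG redG] pG]]]].
  exists (X - 1); last exact: total_deg_X_sub1.
  exists deg_order, [:: X - 1]; split; last by rewrite inE.
    exact: deg_order_monomial.
  exact: X_sub1_reduced_groebner.
suff supp_p v : v \in msupp p -> (v ord0 <= 1)%N.
  rewrite /total_deg -subn1 leq_subLR addn1 msizeE.
  by apply/bigmax_leqP_seq=> v v_p _; rewrite mdegE big_ord1 ltnS supp_p.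
have leadX : ideal_gen (lead_monoms le (toric_ideal A0)) ('X_ord0 : {mpoly K[1]}).
  rewrite -[X]mulr1; apply: ideal_gen_mulr; exists (X - 1), U_(ord0)%MM.
  split=> //; last exact: lead_monom_X_sub1.
  by rewrite X_sub1_binomial; apply: toric_ideal_binomial.
(* As x lies in the initial ideal, the leading monomial of some element of [G] divides it. *)
have [u [g gG lead_u] le_u] :
    exists2 u, (exists2 g, g \in G & is_lead_monom le g u) & (u <= U_(ord0))%MM.
  apply: ideal_gen_monomials; apply: ideal_gen_sub (proj1 (leadG _) leadX).
  by move=> s [g [u [gG lead_u ->]]]; exists u => //; exists g.
have le_u1 : (u ord0 <= 1)%N.
  by move/mnm_lepP/(_ ord0): le_u; rewrite mnm1E eqxx.
move=> v_p; apply: leq_trans le_u1.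
(* If [g] is [p], then [u] is the leading exponent of [p] and bounds [v]; otherwise reducedness
   forbids [u] to divide [v], so [v] is below [u]. *)
have [gp|/eqP gp] := eqVneq g p.
  by apply: (monomial_order_ord1 ord_le); apply: (proj2 lead_u); rewrite gp.
have := redG _ _ _ _ gG pG gp lead_u v_p; apply: contraR; rewrite -ltnNge => lt_uv.
by apply/mnm_lepP=> i; rewrite (ord1 i) ltnW.
Qed.

(** * Markov bases of arbitrarily large degree *)

Lemma ideal_gen_pair (N : {mpoly K[1]} -> Prop) a b p :
  (forall q, N q -> q = a \/ q = b) -> ideal_gen N p ->
  N a \/ exists r, p = b * r.
Proof.
move=> Nab [k [c [g [Ng Ep]]]].
(* The case split is on whether [a] occurs in this finite combination, which is decidable, whereas
   membership in [N] need not be. If it does not occur, all generators used equal [b]. *)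
have [/existsP[i /eqP <-]|/existsPn g_neq_a] := boolP [exists i, g i == a].
  by left.
right; apply: (ideal_gen_dvd (S := fun q => q = b)) => [_ ->|].
  by exists 1; rewrite mulr1.
exists k, c, g; split=> // i.
by case: (Nab _ (Ng i)) => // ga; have := g_neq_a i; rewrite ga eqxx.
Qed.

Lemma X_sub1_not_multiple d r : (1 < d)%N -> X - 1 <> (X ^+ d - 1) * r.
Proof.
move=> d1 E; have := X_sub1_neq0; rewrite E mulf_eq0 negb_or => /andP[d0 r0].
move/(congr1 (fun q : {mpoly K[1]} => msize q)): E.
rewrite msizeM // msize_X_sub1 msize_Xn_sub1 1?ltnW // (mpolySpred _ r0).
by rewrite addnS addSn; case: d d1 {d0} => [|[|d]].
Qed.

Definition consecutive_binomials d p := p = X ^+ d - 1 \/ p = X ^+ d.+1 - 1.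

Lemma consecutive_binomials_markov d :
  (1 < d)%N -> is_markov_basis A0 (consecutive_binomials d).
Proof.
move=> d1; split.
- have binom e : (0 < e)%N -> is_binomial (X ^+ e - 1).
    move=> e0; exists (U_(ord0) *+ e)%MM, 0%MM; rewrite mpolyXn mpolyX0; split=> //.
    by move/eqP; rewrite -mdeg_eq0 mdegMn mdeg1 mul1n -[e]prednK.
  by move=> p [] ->; apply: binom; rewrite // ltnW.
- move=> p; split=> [|/toric_idealP[r ->]].
    move=> gen_p; apply/toric_idealP; apply: ideal_gen_dvd gen_p => s [] ->;
    by apply/toric_idealP; apply: toric_ideal_Xn_sub1.
  (* The coefficients come from multiplying x - 1 = (x^(d+1) - 1) - x (x^d - 1) by [r]. *)
  pose c (i : 'I_2) := if i == ord0 then - X * r else r.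
  pose g (i : 'I_2) := if i == ord0 then X ^+ d - 1 else X ^+ d.+1 - 1.
  exists 2%N, c, g; split=> [i|].
    by rewrite /g; case: ifP; [left | right].
  rewrite big_ord_recl big_ord1 /c /g /= exprS.
  rewrite [- X * r]mulrC -[r * _ * _]mulrA -mulrDr mulrC; congr (_ * _).
  by rewrite mulNr mulrBr mulr1 opprB addrA subrK.
- move=> N NM genN p.
  (* Minimality: if [N] missed one of the two binomials, x - 1 would be a multiple of the other,
     whose degree is at least 2. *)
  have NX : ideal_gen N (X - 1).
    by apply/genN; rewrite -[X]expr1; apply: toric_ideal_Xn_sub1.
  case=> ->.
    case: (ideal_gen_pair NM NX) => // -[r /X_sub1_not_multiple []].
    by rewrite ltnW.
  have NM' q : N q -> q = X ^+ d.+1 - 1 \/ q = X ^+ d - 1 by move/NM=> []; auto.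
  by case: (ideal_gen_pair NM' NX) => // -[r /X_sub1_not_multiple []].
Qed.

Lemma consecutive_binomials_deg d :
  (0 < d)%N -> is_deg_of (consecutive_binomials d) d.+1.
Proof.
move=> d0; split=> [|p [] ->]; rewrite /total_deg.
- by exists (X ^+ d.+1 - 1); [right | rewrite msize_Xn_sub1].
- by rewrite msize_Xn_sub1.
- by rewrite msize_Xn_sub1.
Qed.

End OneVariable.

Theorem theorem3p11 (K : fieldType) (f : nat -> nat) :
  exists (n m : nat) (A : 'I_m -> 'cV[int]_n) (M : {mpoly K[m]} -> Prop),
    injective A /\ is_markov_basis A M /\
    exists degM degGr degU degC : nat,
      is_deg_of M degM /\
      is_deg_of (@graver_basis K n m A) degGr /\
      is_deg_of (@universal_groebner_basis K n m A) degU /\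
      is_deg_of (@circuits K n m A) degC /\
      (f degGr < degM)%N /\ (f degU < degM)%N /\ (f degC < degM)%N.
Proof.
(* The other three degrees are all 1, so only the value f(1) has to be exceeded; d = f(1) + 2
   ensures 1 < d and gives degree f(1) + 3. *)
exists 1%N, 1%N, (fun=> 0), (@consecutive_binomials K (f 1%N).+2).
split; first by move=> i j _; rewrite (ord1 i) (ord1 j).
split; first exact: consecutive_binomials_markov.
exists (f 1%N).+3, 1%N, 1%N, 1%N.
split; first exact: consecutive_binomials_deg.
split; first exact: graver_basis_deg.
split; first exact: universal_groebner_basis_deg.
split; first exact: circuits_deg.
by rewrite !ltnS leqW.
Qed.
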